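(* Let $p$ and $q$ be distinct rational primes, and let $Q$ be a Hurwitz prime of norm $q$. For every Hurwitz prime $P$ of norm $p$ there exist Hurwitz primes $Q'$ of norm $q$ and $P'$ of norm $p$ with $PQ = Q'P'$, and the class of $P'$ modulo left multiplication by units of $\mathcal{H}$ depends only on the class of $P$ modulo left multiplication by units. The resulting map $\tau_Q$ (metacommutation by $Q$) is a permutation of the set of Hurwitz primes of norm $p$ modulo left multiplication by units, and the sign of $\tau_Q$ is the Legendre symbol $\left(\frac{q}{p}\right)$. Moreover, if $p = 2$, or if $Q$ is congruent modulo $p\mathcal{H}$ to a rational integer, then $\tau_Q$ is the identity permutation; otherwise $\tau_Q$ has exactly $1 + \left(\frac{\operatorname{tr}(Q)^2 - 4q}{p}\right)$ fixed points.
   Context: Let $\mathbb{H} = \mathbb{R} + \mathbb{R}i + \mathbb{R}j + \mathbb{R}k$ be the Hamilton quaternions and $\mathcal{H}$ the ring of Hurwitz integers: quaternions $a+bi+cj+dk$ with $a,b,c,d$ all in $\mathbb{Z}$ or all in $\mathbb{Z}+1/2$. For $x = a+bi+cj+dk$, its conjugate is $x^\sigma = a-bi-cj-dk$, its (reduced) norm is $\mathrm{N}(x) = xx^\sigma = a^2+b^2+c^2+d^2$ and its (reduced) trace is $\operatorname{tr}(x) = x + x^\sigma = 2a$. A Hurwitz prime is an element of $\mathcal{H}$ that is irreducible (not a product of two non-units of $\mathcal{H}$); a Hurwitz prime of norm $p$ is one with $\mathrm{N}(P)=p$. $\left(\frac{\cdot}{p}\right)$ denotes the Legendre symbol (for $p$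 odd). *)

(* Defs.v *)
From HB Require Import structures.
From mathcomp Require Import all_boot all_order all_algebra all_fingroup.
From mathcomp Require Import finmap.
From mathcomp Require Import all_classical all_reals.
From mathcomp Require Import zify ring lra.

Set Implicit Arguments.
Unset Strict Implicit.
Unset Printing Implicit Defensive.

Import Order.TTheory GRing.Theory Num.Theory.

Local Open Scope classical_set_scope.
Local Open Scope ring_scope.

(* Quat a b c d is a + b i + c j + d k.  For R a realType, quat R is the
   algebra of Hamilton quaternions. *)
Record quat (R : Type) := Quat { qre : R; qi : R; qj : R; qk : R }.

Section Quaternions.
Variable R : comNzRingType.
Implicit Types x y z : quat R.

Definition tuple_of_quat x := (qre x, qi x, qj x, qk x).
Definition quat_of_tuple (t : R * R * R * R) :=
  let: (a, b, c, d) := t in Quat a b c d.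

Lemma tuple_of_quatK : cancel tuple_of_quat quat_of_tuple.
Proof. by case. Qed.

HB.instance Definition _ := Choice.copy (quat R) (can_type tuple_of_quatK).

Lemma quat_eq x y :
  qre x = qre y -> qi x = qi y -> qj x = qj y -> qk x = qk y -> x = y.
Proof. by case: x => a b c d; case: y => a' b' c' d' /= -> -> -> ->. Qed.

Definition quat0 : quat R := Quat 0 0 0 0.
Definition quat1 : quat R := Quat 1 0 0 0.
Definition oppq x := Quat (- qre x) (- qi x) (- qj x) (- qk x).
Definition addq x y :=
  Quat (qre x + qre y) (qi x + qi y) (qj x + qj y) (qk x + qk y).

(* i^2 = j^2 = k^2 = -1, ij = k = -ji, jk = i = -kj, ki = j = -ik *)
Definition mulq x y :=
  Quat (qre x * qre y - qi x * qi y - qj x * qj y - qk x * qk y)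
       (qre x * qi y + qi x * qre y + qj x * qk y - qk x * qj y)
       (qre x * qj y - qi x * qk y + qj x * qre y + qk x * qi y)
       (qre x * qk y + qi x * qj y - qj x * qi y + qk x * qre y).

Fact addqA : associative addq.
Proof. by move=> x y z; apply: quat_eq => /=; ring. Qed.
Fact addqC : commutative addq.
Proof. by move=> x y; apply: quat_eq => /=; ring. Qed.
Fact add0q : left_id quat0 addq.
Proof. by move=> x; apply: quat_eq => /=; ring. Qed.
Fact addNq : left_inverse quat0 oppq addq.
Proof. by move=> x; apply: quat_eq => /=; ring. Qed.

HB.instance Definition _ :=
  GRing.isZmodule.Build (quat R) addqA addqC add0q addNq.

Fact mulqA : associative mulq.
Proof. by move=> x y z; apply: quat_eq => /=; ring. Qed.
Fact mul1q : left_id quat1 mulq.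
Proof. by move=> x; apply: quat_eq => /=; ring. Qed.
Fact mulq1 : right_id quat1 mulq.
Proof. by move=> x; apply: quat_eq => /=; ring. Qed.
Fact mulqDl : left_distributive mulq addq.
Proof. by move=> x y z; apply: quat_eq => /=; ring. Qed.
Fact mulqDr : right_distributive mulq addq.
Proof. by move=> x y z; apply: quat_eq => /=; ring. Qed.
Fact quat1_neq0 : quat1 != 0.
Proof. by apply/eqP => -[] /eqP; rewrite oner_eq0. Qed.

HB.instance Definition _ := GRing.Zmodule_isNzRing.Build (quat R)
  mulqA mul1q mulq1 mulqDl mulqDr quat1_neq0.

Definition qconj x := Quat (qre x) (- qi x) (- qj x) (- qk x).
Definition qnorm x : R := qre x ^+ 2 + qi x ^+ 2 + qj x ^+ 2 + qk x ^+ 2.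
Definition qtrace x : R := 2 * qre x.

Lemma mulq_conj x : x * qconj x = Quat (qnorm x) 0 0 0.
Proof. by apply: quat_eq; rewrite /= /qnorm; ring. Qed.

Lemma addq_conj x : x + qconj x = Quat (qtrace x) 0 0 0.
Proof. by apply: quat_eq; rewrite /= /qtrace; ring. Qed.

End Quaternions.

Section HurwitzIntegers.
Variable R : realType.

Definition is_hurwitz : pred (quat R) := fun x =>
  [&& qre x \is a Num.int, qi x \is a Num.int,
      qj x \is a Num.int & qk x \is a Num.int]
  || [&& qre x - 2^-1 \is a Num.int, qi x - 2^-1 \is a Num.int,
      qj x - 2^-1 \is a Num.int & qk x - 2^-1 \is a Num.int].

Lemma is_hurwitzP (x : quat R) :
  reflect (exists m a b c : int, x = Quat (m%:~R / 2) (a%:~R + m%:~R / 2)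
                                   (b%:~R + m%:~R / 2) (c%:~R + m%:~R / 2))
          (is_hurwitz x).
Proof.
apply: (iffP orP) => [[]|].
- case: x => a b c d /=.
  move=> /and4P[/intrP[m ->] /intrP[n ->] /intrP[k ->] /intrP[l ->]].
  exists (2 * m), (n - m), (k - m), (l - m).
  by apply: quat_eq; rewrite /= ?intrB intrM; field.
- case: x => a b c d /=.
  move=> /and4P[/intrP[m am] /intrP[n bn] /intrP[k ck] /intrP[l dl]].
  exists (2 * m + 1), (n - m), (k - m), (l - m).
  by apply: quat_eq; rewrite /= ?intrB intrD intrM; lra.
move=> [m [a [b [c ->]]]] /=; pose k := (m %/ 2)%Z.
have /orP[/eqP m0|/eqP m1] : (m %% 2 == 0)%Z || (m %% 2 == 1)%Z.
- have := modz_ge0 m (isT : 2 != 0 :> int).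
  by have := ltz_pmod m (isT : 0 < 2 :> int); case: (m %% 2)%Z => [[|[]]|].
- have -> : m%:~R / 2 = k%:~R :> R.
    by rewrite {1}(divz_eq m 2) m0 addr0 intrM mulfK ?pnatr_eq0.
  by left; rewrite -!intrD !intr_int.
have -> : m%:~R / 2 = k%:~R + 2^-1 :> R.
  by rewrite {1}(divz_eq m 2) m1 intrD intrM -/k; field.
by right; rewrite !addrA !addrK -!intrD !intr_int.
Qed.

Fact is_hurwitz_subring : subring_closed is_hurwitz.
Proof.
split=> [|x y|x y].
- by apply/is_hurwitzP; exists 2, (-1), (-1), (-1); apply: quat_eq => /=; lra.
- move=> /is_hurwitzP[m [a [b [c ->]]]] /is_hurwitzP[m' [a' [b' [c' ->]]]].
  apply/is_hurwitzP; exists (m - m'), (a - a'), (b - b'), (c - c').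
  by apply: quat_eq; rewrite /= ?intrB; ring.
move=> /is_hurwitzP[m [a [b [c ->]]]] /is_hurwitzP[n [d [e [f ->]]]].
apply/is_hurwitzP.
exists (- m * n - m * (d + e + f) - n * (a + b + c)
        - 2 * (a * d + b * e + c * f)).
exists (m * n + m * d + m * f + n * a + n * b
        + a * d + b * e + c * f + b * f - c * e).
exists (m * n + m * d + m * e + n * b + n * c
        + a * d + b * e + c * f - a * f + c * d).
exists (m * n + m * e + m * f + n * a + n * c
        + a * d + b * e + c * f + a * e - b * d).
by apply: quat_eq; rewrite /= !(intrD, intrB, intrM, intrN); field.
Qed.

HB.instance Definition _ :=
  GRing.isSubringClosed.Build (quat R) is_hurwitz is_hurwitz_subring.

Record hurwitz := Hurwitz { hval : quat R; hvalP : is_hurwitz hval }.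

HB.instance Definition _ := [isSub for hval].
HB.instance Definition _ := [Choice of hurwitz by <:].
HB.instance Definition _ := [SubChoice_isSubNzRing of hurwitz by <:].


Implicit Types (P : hurwitz) (p : nat).

Definition htrace (x : hurwitz) : int := Num.floor (qtrace (hval x)).

Lemma htraceE (x : hurwitz) : (htrace x)%:~R = qtrace (hval x).
Proof.
apply: floorK; case: x => _ /= /is_hurwitzP[m [a [b [c ->]]]].
by rewrite /qtrace /= mulrC divfK ?pnatr_eq0// intr_int.
Qed.

Definition hunit (u : hurwitz) := exists v : hurwitz, u * v = 1 /\ v * u = 1.

Definition hurwitz_prime P :=
  ~ hunit P /\ forall x y : hurwitz, P = x * y -> hunit x \/ hunit y.

Definition primes_of_norm p : set hurwitz :=
  [set P | hurwitz_prime P /\ qnorm (hval P) = p%:R].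

Definition left_assoc (x y : hurwitz) := exists2 u, hunit u & y = u * x.

Definition left_class (x : hurwitz) : set hurwitz := [set y | left_assoc x y].

Lemma left_class_eqP (x y : hurwitz) :
  left_class x = left_class y <-> left_assoc x y.
Proof.
split=> [xy|[u [v [uv vu]] ->]].
  have : left_class y y by exists 1; rewrite ?mul1r//; exists 1; rewrite mulr1.
  by rewrite -xy.
apply/seteqP; split=> z [w [t [wt tw]] ->].
  exists (w * v); last by rewrite -mulrA [v * _]mulrA vu mul1r.
  by exists (u * t); rewrite -!mulrA (mulrA v) (mulrA t) vu tw !mul1r.
exists (w * u); last by rewrite mulrA.
by exists (v * t); rewrite -!mulrA (mulrA u) (mulrA t) uv tw !mul1r.
Qed.

Lemma finite_primes_of_norm p : finite_set (primes_of_norm p).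
Proof.
pose h (t : 'I_((4 * p).+1)) : R := (t%:R - (2 * p)%:R) / 2.
pose f (t : 'I_((4 * p).+1) * 'I_((4 * p).+1)
          * ('I_((4 * p).+1) * 'I_((4 * p).+1))) :=
  Quat (h t.1.1) (h t.1.2) (h t.2.1) (h t.2.2).
have fin : finite_set (range f) by exact/finite_image/finite_finset.
apply: (@sub_finite_set _ _ (hval @^-1` (range f))); last first.
  by apply: finite_preimage fin => x y _ _; exact: val_inj.
have hP (r : R) : r ^+ 2 <= p%:R -> 2 * r \is a Num.int -> exists t, h t = r.
  move=> rp /intrP[m rm].
  have mp : `|m| <= (2 * p)%:Z.
    have pp : (p%:R : R) <= p%:R ^+ 2.
      by rewrite -natrX ler_nat -mulnn; case: (p) => // n; exact: leq_pmulr.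
    rewrite -(ler_int R) intr_norm -rm -pmulrn natrM normrM normr_nat ler_pM2l//.
    by rewrite -(ler_pXn2r (n := 2)) ?nnegrE// real_normK ?num_real// (le_trans rp).
  have m0 : 0 <= m + (2 * p)%:Z by lia.
  have [k mk] : exists k : nat, m + (2 * p)%:Z = k%:Z :> int.
    by exists (absz (m + (2 * p)%:Z)); rewrite gez0_abs.
  have lk : (k < (4 * p).+1)%N by lia.
  exists (Ordinal lk); rewrite /h /=.
  have -> : k%:R = 2 * r + (2 * p)%:R :> R.
    by rewrite rm -[k%:R]/(k%:~R) -mk intrD.
  by rewrite addrK; field.
move=> [[a b c d] xH] [_]; rewrite /= /qnorm /= => norm_x.
have sq2 (r : R) : 0 <= r ^+ 2 by exact: sqr_ge0.
have [i2 j2 k2 l2] : [/\ 2 * a \is a Num.int, 2 * b \is a Num.int,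
    2 * c \is a Num.int & 2 * d \is a Num.int].
  have /is_hurwitzP[m [e [f' [g [-> -> -> ->]]]]] := xH.
  have m2 : 2 * (m%:~R / 2) = m%:~R :> R by field.
  split; rewrite ?mulrDr m2 ?[2]pmulrn -?intrM -?intrD; exact: intr_int.
have := (sq2 a, sq2 b, sq2 c, sq2 d) => -[[[a0 b0] c0] d0].
have [|i hi] := hP a _ i2; first by lra.
have [|j hj] := hP b _ j2; first by lra.
have [|k hk] := hP c _ k2; first by lra.
have [|l hl] := hP d _ l2; first by lra.
by exists ((i, j), (k, l)) => //=; rewrite /f /= hi hj hk hl.
Qed.

(* The set of Hurwitz primes of norm p modulo left multiplication by units;
   as a finite set, it is also a finType. *)
Definition prime_classes p : {fset set hurwitz} :=
  fset_set (left_class @` primes_of_norm p).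

Lemma mem_prime_classes p P :
  primes_of_norm p P -> left_class P \in prime_classes p.
Proof.
move=> Pp; rewrite in_fset_set ?inE; first by exists P.
exact/finite_image/finite_primes_of_norm.
Qed.

Definition prime_class p P (Pp : primes_of_norm p P) : prime_classes p :=
  FSetSub (mem_prime_classes Pp).

Lemma prime_classP p (C : prime_classes p) :
  exists P (Pp : primes_of_norm p P), C = prime_class Pp.
Proof.
have := valP C; rewrite in_fset_set ?inE.
  by move=> -[P Pp PC]; exists P, Pp; exact/val_inj.
exact/finite_image/finite_primes_of_norm.
Qed.

Definition congr_integer p (Q : hurwitz) :=
  exists (n : int) (x : hurwitz), Q - n%:~R = p%:R * x.

End HurwitzIntegers.

(* Used only for p prime.  For p = 2 the value is that of the quadratic
   character modulo 2, namely 1 at odd a; it is not the Kronecker symbol. *)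
Definition legendre (a : int) (p : nat) : int :=
  if (p %| a)%Z then 0
  else if `[< exists x : int, (x ^+ 2 = a %[mod p])%Z >] then 1 else -1.

(* Main.v *)
(** For odd p, reduction modulo p maps the Hurwitz integers onto M_2(F_p) with
    kernel generated by p.  A prime P of norm p becomes a nonzero singular
    matrix, and its left class is determined by the point of P^1(F_p) killed by
    that matrix: the elements killing a given point form a left ideal, which is
    principal by Euclidean division, with a generator of norm p.  If
    PQ = Q'P' then Q maps the point of P' to the point of P, so tau_Q is
    conjugate to the inverse of the projective transformation given by Q.  Its
    fixed points are the eigenlines of Q.  Its sign is computed by an LDU
    decomposition: transvections are squares, hence even, and diag(1, g) with g
    a generator of F_p^* is odd.  For p = 2 there is only one class, that of
    1 + i. *)
Require Import Defs.
From HB Require Import structures.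
From mathcomp Require Import all_boot all_order all_algebra all_fingroup.
From mathcomp Require Import finmap cyclic finfield.
From mathcomp Require Import all_classical all_reals.
From mathcomp Require Import zify ring lra.

Set Implicit Arguments.
Unset Strict Implicit.
Unset Printing Implicit Defensive.

Import Order.TTheory GRing.Theory Num.Theory.

Local Open Scope ring_scope.

(** Writing [s] as a product of transpositions, [f] carries each of them to a transposition of [T'].
    This transports the sign between prime classes and the projective line, which are different
    types. *)
Lemma odd_perm_bij (T T' : finType) (f : T -> T') (s : {perm T})
    (s' : {perm T'}) :
  bijective f -> (forall x, s' (f x) = f (s x)) -> odd_perm s' = odd_perm s.
Proof.
move=> bf; have injf := bij_inj bf.
have [ts def_s dpts] := prod_tpermP s; rewrite {}def_s => ss'.
pose ts' := [seq (f t.1, f t.2) | t <- ts].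
have -> : s' = (\prod_(t <- ts') tperm t.1 t.2)%g.
  have [g fK gK] := bf; apply/permP => y; rewrite -[y]gK ss' /ts'.
  elim: ts {dpts ss' ts'} (g y) => [|t ts IH] x; rewrite !(big_nil, big_cons)/=.
    by rewrite !perm1.
  by rewrite !permM IH (inj_tperm _ _ _ injf).
rewrite !odd_perm_prod ?size_map//.
by rewrite all_map; apply: sub_all dpts => t /=; rewrite /dpair /= inj_eq.
Qed.

(** * Squares and primitive roots in a finite field of odd characteristic *)

Section OddFiniteField.
Variable F : finFieldType.
Hypothesis F2 : 2%:R != 0 :> F.

Definition is_square (x : F) := [exists y : F, y ^+ 2 == x].

Lemma is_squareP x : reflect (exists y, y ^+ 2 = x) (is_square x).
Proof. by apply: (iffP existsP) => -[y /eqP yx]; exists y => //; apply/eqP. Qed.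

Lemma finField_primitive : exists g : F, #|F|.-1.-primitive_root g.
Proof.
have F1 := finNzRing_gt1 F.
pose s := [seq x <- enum F | x != 0].
have F0 : (0 < #|F|.-1)%N by case: #|F| F1 => [|[]].
have: has (#|F|.-1).-primitive_root s.
  apply: has_prim_root => //.
  - apply/allP => x; rewrite mem_filter => /andP[x0 _].
    rewrite unity_rootE; apply/eqP/(mulIf x0).
    by rewrite -exprSr prednK ?mul1r ?expf_card// (ltnW F1).
  - by rewrite filter_uniq ?enum_uniq.
  have us : uniq s by rewrite filter_uniq ?enum_uniq.
  rewrite -(card_uniqP us) -(cardC1 (0 : F)) subset_leq_card//.
  by apply/fintype.subsetP => x; rewrite !inE mem_filter mem_enum andbT.
by case/hasP => g _ gP; exists g.
Qed.

(** If [#|F|] were even, then -1 = (-1)^[#|F|] = 1, contradicting [F2]. *)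
Lemma odd_card_finField : odd #|F|.
Proof.
apply: contraNT F2 => Fev; have := expf_card (-1 : F).
by rewrite -signr_odd (negPf Fev) expr0 => e; rewrite mulr2n {1}e addNr.
Qed.

Lemma nonzero_powP (g : F) : #|F|.-1.-primitive_root g ->
  forall x, x != 0 -> exists n, x = g ^+ n.
Proof.
move=> gP x x0.
have xF : x ^+ #|F|.-1 = 1.
  apply: (mulIf x0); rewrite -exprSr prednK ?mul1r ?expf_card//.
  exact: ltnW (finNzRing_gt1 F).
by have [i ->] := prim_rootP gP xF; exists i.
Qed.

Lemma primitive_root_neq0 (g : F) : #|F|.-1.-primitive_root g -> g != 0.
Proof.
move=> gP; apply/eqP => g0; move: gP; rewrite g0 => /prim_expr_order.
have := finNzRing_gt1 F; case: #|F| => [|[|k]]//= _ /eqP.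
by rewrite expr0n eq_sym oner_eq0.
Qed.

(** The order [#|F|.-1] of [g] is even, so the parity of an exponent depends only on the power of
    [g]. *)
Lemma is_square_pow (g : F) n : #|F|.-1.-primitive_root g ->
  is_square (g ^+ n) = ~~ odd n.
Proof.
move=> gP; apply/is_squareP/idP => [[y yn]|ev]; last first.
  by exists (g ^+ n./2); rewrite -exprM muln2 even_halfK.
have y0 : y != 0.
  apply: contra_eqN yn => /eqP ->; rewrite expr0n eq_sym expf_neq0//.
  exact: primitive_root_neq0 gP.
have [m ym] := nonzero_powP gP y0.
have ev1 : odd #|F|.-1 = false.
  by have := odd_card_finField; case: #|F| => //= k /negPf.
move/eqP: yn; rewrite ym -exprM (eq_prim_root_expr gP).
move=> /eqP/(congr1 odd).
have modd k : odd (k %% #|F|.-1) = odd k.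
  by rewrite [in RHS](divn_eq k #|F|.-1) oddD oddM ev1 andbF.
by rewrite !modd oddM andbF => <-.
Qed.

(** Pigeonhole: the set [S] of squares has more than half of the elements of [F], so it meets
    [c - S]. The case c = -1 later splits the quaternions over [F_p]. *)
Lemma sum_two_squares (c : F) : exists a b : F, a ^+ 2 + b ^+ 2 = c.
Proof.
have [g gP] := finField_primitive.
pose S := [set x | is_square x].
have memS y : y ^+ 2 \in S by rewrite inE; apply/is_squareP; exists y.
have cS : (#|F| < #|S| + #|S|)%N.
  (* [S] and [g * S] cover [F] and share 0, hence [#|F| + 1 <= 2 * #|S|]. *)
  pose gS := [set g * x | x in S].
  have cgS : (#|gS| <= #|S|)%N by exact: leq_imset_card.
  apply: (@leq_trans (#|S| + #|gS|)); last by rewrite leq_add2l.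
  rewrite -cardsUI -cardsT -addn1 leq_add//.
    apply/subset_leq_card/fintype.subsetP => x _.
    have [->|x0] := eqVneq x 0.
      have := memS 0; rewrite expr0n/= => S0; by rewrite finset.in_setU S0.
    have [n ->] := nonzero_powP gP x0.
    rewrite -[n]odd_double_half -muln2 exprD exprM finset.in_setU.
    case: (odd n); last by rewrite mul1r memS.
    by apply/orP; right; apply/imsetP; exists (g ^+ n./2 ^+ 2).
  apply/card_gt0P; exists 0; have S0 : 0 \in S by have := memS 0; rewrite expr0n.
  by rewrite finset.in_setI S0/=; apply/imsetP; exists 0; rewrite ?mulr0.
pose T := [set c - x | x in S].
have cT : #|T| = #|S| by rewrite card_imset// => x y /subrI.
have /card_gt0P[x] : (0 < #|S :&: T|)%N.
  have := cardsUI S T; rewrite cT => ST.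
  have : (#|S :|: T| <= #|F|)%N by exact: max_card.
  by lia.
rewrite finset.in_setI => /andP[]; rewrite inE => /is_squareP[a <-] /imsetP[y].
rewrite inE => /is_squareP[b <-] ab; exists a, b.
by rewrite ab subrK.
Qed.

End OddFiniteField.

(** * The projective line over a finite field *)

Section Mobius.
Variable F : finFieldType.

Lemma ord2P (i : 'I_2) : i = 0 \/ i = 1.
Proof. by case: i => -[|[|]]// h; [left|right]; apply/val_inj. Qed.

Definition mx2 (a b c d : F) : 'M[F]_2 :=
  \matrix_(i, j) (if i == 0 then if j == 0 then a else b
                  else if j == 0 then c else d).

Lemma mx2P (A : 'M[F]_2) : A = mx2 (A 0 0) (A 0 1) (A 1 0) (A 1 1).
Proof.
by apply/matrixP => i j; rewrite mxE; have [->|->] := ord2P i; have [->|->] := ord2P j.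
Qed.

Lemma mx2M a b c d a' b' c' d' : mx2 a b c d *m mx2 a' b' c' d' =
  mx2 (a * a' + b * c') (a * b' + b * d') (c * a' + d * c') (c * b' + d * d').
Proof.
apply/matrixP => i j; rewrite !mxE !big_ord_recl big_ord0 !mxE addr0 /=.
by case: (i == 0); case: (j == 0).
Qed.

Lemma det_mx2E a b c d : \det (mx2 a b c d) = a * d - b * c.
Proof.
rewrite (expand_det_row _ 0) !big_ord_recl big_ord0 /cofactor !det_mx11 !mxE /=.
by rewrite addr0 expr0 expr1 mul1r mulN1r mulrN. Qed.

(* The projective line is option F: Some t is [1 : t] and None is [0 : 1]. *)
Definition pvec (t : option F) : 'cV[F]_2 :=
  \col_i (if t is Some t then if i == 0 then 1 else t
          else if i == 0 then 0 else 1).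

(** The zero vector, which spans no line, is also sent to [None]. *)
Definition ppoint (v : 'cV[F]_2) : option F :=
  if v 0 0 == 0 then None else Some (v 1 0 / v 0 0).

Lemma pvec_neq0 t : pvec t != 0.
Proof.
apply/eqP; case: t => [t|] /colP; first by move=> /(_ 0)/eqP; rewrite !mxE oner_eq0.
by move=> /(_ 1)/eqP; rewrite !mxE oner_eq0.
Qed.

Lemma pvecK : cancel pvec ppoint.
Proof. by case=> [t|]; rewrite /ppoint !mxE/= ?oner_eq0 ?eqxx ?divr1. Qed.

Lemma ppointZ c v : c != 0 -> ppoint (c *: v) = ppoint v.
Proof.
move=> c0; rewrite /ppoint !mxE mulf_eq0 (negPf c0)/=.
by case: ifP => // /negbT v0; congr Some; field; rewrite c0 v0.
Qed.

Lemma pvec_ppoint v : v != 0 -> exists2 c, c != 0 & v = c *: pvec (ppoint v).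
Proof.
move=> v0; rewrite /ppoint; case: ifPn => [/eqP v00|v00].
  have v10 : v 1 0 != 0.
    apply: contraNneq v0 => v10; apply/eqP/colP => i; rewrite !mxE.
    by have [->|->] := ord2P i.
  exists (v 1 0) => //; apply/colP => i; rewrite !mxE.
  by have [->|->] := ord2P i => /=; rewrite ?mulr0 ?mulr1.
exists (v 0 0) => //; apply/colP => i; rewrite !mxE.
by have [->|->] := ord2P i => /=; rewrite ?mulr1// mulrC divfK.
Qed.

Lemma colin_pvec (t u : option F) (c : F) :
  c *: pvec t = pvec u -> t = u.
Proof.
move=> cu; have c0 : c != 0.
  by apply: contraNneq (pvec_neq0 u) => c0; rewrite -cu c0 scale0r.
by rewrite -[t]pvecK -(ppointZ _ c0) cu pvecK.
Qed.

(** Vectors of distinct points are linearly independent, so only the zero matrix kills both. *)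
Lemma pvec_kernel_unique (A : 'M[F]_2) t t' :
  A != 0 -> A *m pvec t = 0 -> A *m pvec t' = 0 -> t = t'.
Proof.
move=> A0 At At'; apply/eqP; apply: contraNT A0 => tt'.
have row0 s i : A *m pvec s = 0 ->
    A i 0 * pvec s 0 0 + A i 1 * pvec s 1 0 = 0.
  move=> /matrixP/(_ i 0); rewrite [_ 0 in RHS]mxE => <-.
  rewrite [RHS]mxE !big_ord_recl big_ord0 addr0.
  by rewrite (_ : lift ord0 ord0 = 1)//; exact/val_inj.
have Ai i : A i 0 = 0 /\ A i 1 = 0.
  have := (row0 _ i At, row0 _ i At'); rewrite !mxE /=.
  case: t t' tt' {At At'} => [a|] [b|] //= ab [];
    rewrite ?mulr1 ?mulr0 ?add0r => e1 e2.
  - have ba : b - a != 0 by rewrite subr_eq0 eq_sym.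
    have Ai1 : A i 1 = 0.
      apply: (mulIf ba); rewrite mul0r.
      rewrite (_ : _ * _ = (A i 0 + A i 1 * b) - (A i 0 + A i 1 * a)).
        by rewrite e1 e2 subrr.
      by ring.
    by split=> //; rewrite -e1 Ai1 mul0r addr0.
  - by split=> //; rewrite -e1 e2 mul0r addr0.
  - by split=> //; rewrite -e2 e1 mul0r addr0.
by apply/eqP/matrixP => i j; rewrite mxE; have [->|->] := ord2P j; case: (Ai i).
Qed.

Definition mobius (A : 'M[F]_2) t := ppoint (A *m pvec t).

Lemma unitmx_mulv_neq0 (A : 'M[F]_2) (v : 'cV[F]_2) :
  A \in unitmx -> v != 0 -> A *m v != 0.
Proof.
move=> uA; apply: contraNneq => Av0.
by rewrite -[v]mul1mx -(mulVmx uA) -mulmxA Av0 mulmx0.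
Qed.

Lemma mul_pvec A t : A \in unitmx ->
  exists2 c, c != 0 & A *m pvec t = c *: pvec (mobius A t).
Proof. by move=> uA; apply/pvec_ppoint/unitmx_mulv_neq0/pvec_neq0. Qed.

Lemma mobiusP A t u : A \in unitmx ->
  (mobius A t = u) <-> (exists c, A *m pvec t = c *: pvec u).
Proof.
move=> uA; split=> [<-|[c Atu]].
  by have [c _ ->] := mul_pvec t uA; exists c.
have [d d0 Adu] := mul_pvec t uA; apply: (@colin_pvec _ _ (c^-1 * d)).
have c0 : c != 0.
  apply: contraNneq (unitmx_mulv_neq0 uA (pvec_neq0 t)) => c0.
  by rewrite Atu c0 scale0r.
by rewrite -scalerA -Adu Atu scalerA mulVf// scale1r.
Qed.

Lemma mobius_kernel (A B : 'M[F]_2) t : B \in unitmx ->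
  A *m B *m pvec t = 0 -> A *m pvec (mobius B t) = 0.
Proof.
move=> uB; have [c c0 Bt] := mul_pvec t uB; rewrite -mulmxA Bt -scalemxAr.
by move=> /(congr1 ( *:%R c^-1)); rewrite scalerA mulVf// scale1r scaler0.
Qed.

Lemma mobiusM A B t : B \in unitmx -> mobius (A *m B) t = mobius A (mobius B t).
Proof.
move=> uB; have [c c0 Bt] := mul_pvec t uB.
by rewrite {1}/mobius -mulmxA Bt -scalemxAr (ppointZ _ c0).
Qed.

Lemma mobius1 t : mobius 1%:M t = t.
Proof. by rewrite /mobius mul1mx pvecK. Qed.

Lemma mobius_inj A : A \in unitmx -> injective (mobius A).
Proof.
move=> uA; apply: (can_inj (g := mobius (invmx A))) => t.
by rewrite -mobiusM// mulVmx// mobius1.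
Qed.

Definition mobius_perm A (uA : A \in unitmx) := perm (mobius_inj uA).

(** The factors are swapped because permutations compose from left to right. *)
Lemma mobius_permM A B (uA : A \in unitmx) (uB : B \in unitmx)
    (uAB : A *m B \in unitmx) :
  mobius_perm uAB = (mobius_perm uB * mobius_perm uA)%g.
Proof. by apply/permP => t; rewrite permM !permE mobiusM. Qed.

Lemma odd_mobius_permM A B (uA : A \in unitmx) (uB : B \in unitmx)
    (uAB : A *m B \in unitmx) :
  odd_perm (mobius_perm uAB) = odd_perm (mobius_perm uA) (+) odd_perm (mobius_perm uB).
Proof. by rewrite (mobius_permM uA uB) odd_permM addbC. Qed.

End Mobius.

(** * Sign and fixed points of a projective transformation in odd characteristic *)

Section MobiusSign.
Variable F : finFieldType.
Hypothesis F2 : 2%:R != 0 :> F.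

Lemma unit_mx2 (a b c d : F) :
  (mx2 a b c d \in unitmx) = (a * d - b * c != 0).
Proof. by rewrite unitmxE det_mx2E unitfE. Qed.

Lemma odd_mobius_square (A B : 'M[F]_2) (uA : A \in unitmx)
    (uB : B \in unitmx) : A = B *m B -> odd_perm (mobius_perm uA) = false.
Proof. by move=> AB; subst A; rewrite (odd_mobius_permM uB uB) addbb. Qed.

Lemma odd_mobius_lower (c : F) (u : mx2 1 0 c 1 \in unitmx) :
  odd_perm (mobius_perm u) = false.
Proof.
have u2 : mx2 1 0 (c / 2%:R) 1 \in unitmx by rewrite unit_mx2 mul0r subr0 mulr1 oner_eq0.
apply: (odd_mobius_square u u2).
by rewrite mx2M; congr mx2; field.
Qed.

Lemma odd_mobius_upper (b : F) (u : mx2 1 b 0 1 \in unitmx) :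
  odd_perm (mobius_perm u) = false.
Proof.
have u2 : mx2 1 (b / 2%:R) 0 1 \in unitmx by rewrite unit_mx2 mulr0 subr0 mulr1 oner_eq0.
apply: (odd_mobius_square u u2).
by rewrite mx2M; congr mx2; field.
Qed.

Lemma mobius_diag (a d : F) t : a != 0 -> d != 0 ->
  mobius (mx2 a 0 0 d) t = omap ( *%R (d / a)) t.
Proof.
move=> a0 d0; have ua : mx2 a 0 0 d \in unitmx.
  by rewrite unit_mx2 mulr0 subr0 mulf_neq0.
apply/(mobiusP _ _ ua); case: t => [t|] /=; [exists a|exists d];
  apply/colP => i; rewrite !mxE !big_ord_recl big_ord0 !mxE /=;
  have [->|->] := ord2P i => /=; by field.
Qed.

(* Multiplication by a generator of F^* has the orbits {oo}, {0} and F^* on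
   the projective line, which has even cardinal. *)
Lemma odd_mobius_primitive (g : F) (u : mx2 1 0 0 g \in unitmx) :
  #|F|.-1.-primitive_root g -> odd_perm (mobius_perm u).
Proof.
move=> gP; have g0 : g != 0.
  by move: u; rewrite unit_mx2 mul1r mul0r subr0.
set s := mobius_perm u.
have sX n t : (s ^+ n)%g t = omap ( *%R (g ^+ n)) t.
  elim: n t => [|n IH] t; first by rewrite expg0 perm1; case: t => //= t; rewrite mul1r.
  rewrite expgS permM IH permE mobius_diag ?oner_eq0//.
  by case: t => //= t; rewrite divr1 mulrA -exprSr.
have s0 : porbit s None = [set None].
  apply/setP => t; rewrite inE; apply/porbitP/eqP => [[n ->]|->].
    by rewrite sX.
  by exists 0%N; rewrite sX.
have s1 : porbit s (Some 0) = [set Some 0].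
  apply/setP => t; rewrite inE; apply/porbitP/eqP => [[n ->]|->].
    by rewrite sX /= mulr0.
  by exists 0%N; rewrite sX /= mulr0.
have s2 x : x != 0 -> porbit s (Some x) = ~: [set None; Some 0].
  move=> x0; apply/setP => t; rewrite !inE; apply/porbitP/idP => [[n ->]|].
    by rewrite sX /= (inj_eq Some_inj) mulf_neq0// expf_neq0.
  case: t => //= t; rewrite (inj_eq Some_inj) => t0.
  have [n tx] := nonzero_powP gP (mulf_neq0 t0 (invr_neq0 x0)).
  by exists n; rewrite sX /= -tx divfK.
have sE : porbits s = [set porbit s None; porbit s (Some 0); porbit s (Some 1)].
  apply/setP => X; rewrite !inE; apply/imsetP/idP => [[[x|] _ ->]|].
  - have [->|x0] := eqVneq x 0; first by rewrite eqxx orbT.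
    by rewrite (s2 x)// (s2 1) ?oner_eq0// eqxx orbT.
  - by rewrite eqxx.
  by move=> /orP[/orP[]|] /eqP ->; [exists None|exists (Some 0)|exists (Some 1)].
(* The sign is the parity of the number of points plus the number of orbits: [#|F| + 1] is even and
   there are three orbits. *)
rewrite /odd_perm sE card_option /= (odd_card_finField F2) s0 s1 s2 ?oner_eq0//.
rewrite -finset.setUA cardsU1 cards2 !inE.
case: eqP => [/finset.setP/(_ None)|_]; first by rewrite !inE.
case: eqP => [/finset.setP/(_ None)|_]; first by rewrite !inE.
by case: eqP => [/finset.setP/(_ (Some 0))|_]; first by rewrite !inE eqxx orbT.
Qed.

Lemma odd_mobius_eq A B (uA : A \in unitmx) (uB : B \in unitmx) :
  @mobius F A =1 mobius B ->
  odd_perm (mobius_perm uA) = odd_perm (mobius_perm uB).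
Proof. by move=> AB; congr odd_perm; apply/permP => t; rewrite !permE AB. Qed.

(** The map is multiplication by d/a = g^n, the n-th iterate of an odd permutation, and ad differs
    from d/a by the square of a. *)
Lemma odd_mobius_diag (a d : F) (u : mx2 a 0 0 d \in unitmx) :
  odd_perm (mobius_perm u) = ~~ is_square (a * d).
Proof.
have /andP[a0 d0] : (a != 0) && (d != 0).
  by rewrite -negb_or -mulf_eq0; move: u; rewrite unit_mx2 mulr0 subr0.
have [g gP] := finField_primitive F.
have g0 : g != 0 by exact: (primitive_root_neq0 gP).
have u1 n : mx2 1 0 0 (g ^+ n) \in unitmx.
  by rewrite unit_mx2 mul1r mul0r subr0 expf_neq0.
have odd1 n : odd_perm (mobius_perm (u1 n)) = odd n.
  elim: n => [|n IH].
    rewrite -[RHS](odd_perm1 (option F)); congr odd_perm; apply/permP => t.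
    by rewrite permE mobius_diag ?oner_eq0// perm1; case: t => //= t; rewrite divr1 mul1r.
  have ug : mx2 1 0 0 g \in unitmx by rewrite unit_mx2 mul1r mul0r subr0.
  have ugn : mx2 1 0 0 g *m mx2 1 0 0 (g ^+ n) \in unitmx.
    by rewrite unitmx_mul ug u1.
  have -> : odd_perm (mobius_perm (u1 n.+1)) = odd_perm (mobius_perm ugn).
    apply: odd_mobius_eq => t; congr (mobius _ t); rewrite mx2M exprS.
    by congr mx2; ring.
  by rewrite (odd_mobius_permM ug (u1 n)) odd_mobius_primitive// IH.
have [n dan] := nonzero_powP gP (mulf_neq0 d0 (invr_neq0 a0)).
have -> : is_square (a * d) = is_square (d / a).
  apply/is_squareP/is_squareP => -[y yE].
    by exists (y / a); rewrite exprMn yE; field.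
  by exists (y * a); rewrite exprMn yE; field.
rewrite dan (is_square_pow F2 n gP) negbK -odd1.
apply: odd_mobius_eq => t; rewrite !mobius_diag ?oner_eq0 ?expf_neq0//.
by rewrite -dan divr1.
Qed.

Lemma odd_mobius_perm A (u : A \in unitmx) :
  odd_perm (mobius_perm u) = ~~ is_square (\det (A : 'M[F]_2)).
Proof.
have main (a b c d : F) (v : mx2 a b c d \in unitmx) : a != 0 ->
    odd_perm (mobius_perm v) = ~~ is_square (a * d - b * c).
  (* LDU decomposition with pivot [a]; [e] is the Schur complement, so that [a * e] is the
     determinant. *)
  move=> a0; set e := d - b * c / a.
  have E : mx2 a b c d =
      mx2 1 0 (c / a) 1 *m mx2 a 0 0 e *m mx2 1 (b / a) 0 1.
    by rewrite !mx2M /e; congr mx2; field.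
  have aeE : a * d - b * c = a * e by rewrite /e; field.
  have ae0 : a * e != 0 by rewrite -aeE -unit_mx2.
  have uL : mx2 1 0 (c / a) 1 \in unitmx.
    by rewrite unit_mx2 mul0r subr0 mulr1 oner_eq0.
  have uU : mx2 1 (b / a) 0 1 \in unitmx.
    by rewrite unit_mx2 mulr0 subr0 mulr1 oner_eq0.
  have uD : mx2 a 0 0 e \in unitmx by rewrite unit_mx2 mul0r subr0.
  have uLD : mx2 1 0 (c / a) 1 *m mx2 a 0 0 e \in unitmx.
    by rewrite unitmx_mul uL uD.
  have uLDU : mx2 1 0 (c / a) 1 *m mx2 a 0 0 e *m mx2 1 (b / a) 0 1 \in unitmx.
    by rewrite unitmx_mul uLD uU.
  rewrite (@odd_mobius_eq _ _ v uLDU); last by rewrite E.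
  rewrite (odd_mobius_permM uLD uU) (odd_mobius_permM uL uD).
  by rewrite odd_mobius_lower odd_mobius_upper odd_mobius_diag addbF aeE.
move: u; rewrite (mx2P A); move: (A 0 0) (A 0 1) (A 1 0) (A 1 1) => a b c d u.
rewrite det_mx2E; have [a0|a0] := eqVneq a 0; last exact: main.
have c0 : c != 0.
  by apply: contraTneq u => c0; rewrite unit_mx2 a0 c0 mul0r mulr0 subr0 eqxx.
(* When [a] vanishes, adding the second row to the first puts the nonzero [c] in the corner; this
   transvection changes neither the determinant nor the sign. *)
have uU : mx2 (1 : F) 1 0 1 \in unitmx.
  by rewrite unit_mx2 mulr0 subr0 mulr1 oner_eq0.
have uUA : mx2 1 1 0 1 *m mx2 a b c d \in unitmx by rewrite unitmx_mul uU u.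
have E : mx2 1 1 0 1 *m mx2 a b c d = mx2 c (b + d) c d.
  by rewrite mx2M a0; congr mx2; ring.
have v : mx2 c (b + d) c d \in unitmx by rewrite -E.
have := odd_mobius_permM uU u uUA; rewrite odd_mobius_upper /= => <-.
rewrite (@odd_mobius_eq _ _ uUA v); last by rewrite E.
by rewrite main// a0; congr (~~ is_square _); ring.
Qed.

Definition quadratic_char (x : F) : int :=
  if x == 0 then 0 else if is_square x then 1 else -1.

Lemma card_sqrt (x : F) : #|[set y : F | y ^+ 2 == x]|%:Z = 1 + quadratic_char x.
Proof.
rewrite /quadratic_char; have [->|x0] := eqVneq x 0.
  rewrite (_ : [set _ | _] = [set 0]) ?cards1//.
  by apply/setP => y; rewrite !inE sqrf_eq0.
case: is_squareP => [[y yx]|nsq].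
  rewrite (_ : [set _ | _] = [set y; - y]); last first.
    by apply/setP => z; rewrite !inE -yx eqf_sqr.
  have y0 : y != 0 by apply: contraNneq x0 => y0; rewrite -yx y0 expr0n.
  rewrite cards2 -subr_eq0 opprK -mulr2n -mulr_natr mulf_eq0 negb_or y0 F2.
  by [].
rewrite (_ : [set _ | _] = finset.set0) ?cards0//.
by apply/setP => y; rewrite !inE; apply/eqP => yx; apply: nsq; exists y.
Qed.

(** Fixed points are eigenlines, counted by the square roots of the discriminant of the
    characteristic polynomial. In coordinates, [1 : t] is fixed when b t^2 + (a - d) t - c = 0, and
    [None] is fixed when b = 0. *)
Lemma mobius_fixed_points (A : 'M[F]_2) : A \in unitmx ->
  ~~ is_scalar_mx A ->
  #|[set t | mobius A t == t]|%:Z = 1 + quadratic_char (\tr A ^+ 2 - 4%:R * \det A).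
Proof.
rewrite (mx2P A); move: (A 0 0) (A 0 1) (A 1 0) (A 1 1) => a b c d u nsc.
have -> : \tr (mx2 a b c d) = a + d.
  by rewrite /mxtrace !big_ord_recl big_ord0 !mxE addr0.
have -> : (a + d) ^+ 2 - 4%:R * \det (mx2 a b c d) =
    (a - d) ^+ 2 + 4%:R * (b * c) by rewrite det_mx2E; ring.
have fixN : (mobius (mx2 a b c d) None == None) = (b == 0).
  apply/eqP/eqP => [/(mobiusP _ _ u)[e /colP/(_ 0)]|b0].
    by rewrite !mxE !big_ord_recl big_ord0 !mxE /= mulr0 mulr1 add0r addr0 mulr0.
  apply/(mobiusP _ _ u); exists d; apply/colP => i.
  rewrite !mxE !big_ord_recl big_ord0 !mxE /= b0.
  by have [->|->] := ord2P i => /=; ring.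
have fixS t : (mobius (mx2 a b c d) (Some t) == Some t) =
    (c + d * t == t * (a + b * t)).
  apply/eqP/eqP => [/(mobiusP _ _ u)[e /colP E]|E].
    have := E 0; have := E 1; rewrite !mxE !big_ord_recl !big_ord0 !mxE /= !mulr1 !addr0.
    by move=> -> ->; rewrite mulrC.
  apply/(mobiusP _ _ u); exists (a + b * t); apply/colP => i.
  rewrite !mxE !big_ord_recl big_ord0 !mxE /= mulr1 addr0.
  by have [->|->] := ord2P i => /=; rewrite ?E; ring.
(* For b = 0 the equation is linear and the discriminant is (a - d)^2. If a = d, then c is nonzero
   because the matrix is not scalar, and only [None] is fixed; otherwise there is one further
   point. *)
have [b0|b0] := eqVneq b 0.
  have [ad|ad] := eqVneq a d.
    have c0 : c != 0.
      apply: contraNneq nsc => c0; apply/is_scalar_mxP; exists a; apply/matrixP => i j.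
      by rewrite !mxE c0 b0 -ad; have [->|->] := ord2P i; have [->|->] := ord2P j.
    rewrite (_ : [set _ | _] = [set None]).
      rewrite cards1 ad b0 subrr expr0n mul0r mulr0 addr0.
      by rewrite /quadratic_char eqxx.
    apply/setP => -[t|]; rewrite !inE ?fixN ?fixS b0 ?eqxx// ad.
    by rewrite mul0r addr0 [t * d]mulrC -subr_eq0 addrK (negPf c0).
  rewrite (_ : [set _ | _] = [set None; Some (c / (a - d))]).
    rewrite cards2 b0 mul0r mulr0 addr0 /quadratic_char sqrf_eq0 subr_eq0 (negPf ad).
    by case: is_squareP => // -[]; exists (a - d).
  apply/setP => -[t|]; rewrite !inE ?fixN ?fixS b0 ?eqxx//= (inj_eq Some_inj).
  rewrite mul0r addr0 -subr_eq0 -[in RHS]subr_eq0.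
  have ad0 : a - d != 0 by rewrite subr_eq0.
  have -> : t - c / (a - d) = (c + d * t - t * a) * (- (a - d)^-1) by field.
  by rewrite mulf_eq0 oppr_eq0 invr_eq0 (negPf ad0) orbF.
rewrite -card_sqrt.
(* Quadratic formula: [f] maps the square roots of the discriminant bijectively to the fixed
   points. *)
pose f (y : F) : option F := Some ((y - (a - d)) / (2%:R * b)).
have f_inj : injective f.
  move=> y z [] /(mulIf (invr_neq0 (mulf_neq0 F2 b0))).
  by move=> /addIr.
rewrite -(card_imset _ f_inj); congr (Posz #|pred_of_set _|).
apply/setP => t; rewrite inE; apply/idP/imsetP.
  case: t => [t|]; last by rewrite fixN (negPf b0).
  rewrite fixS => /eqP E; exists (2%:R * b * t + (a - d)).
    rewrite inE; apply/eqP.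
    have -> : b * c = b * (c + d * t) - b * d * t by ring.
    by rewrite E; ring.
  by rewrite /f addrK [2%:R * b * t]mulrC mulfK// mulf_neq0.
case=> y; rewrite inE => /eqP yE ->{t}; rewrite fixS -subr_eq0.
set t := _ / _; have {}yE : (2%:R * b * t + (a - d)) ^+ 2 = (a - d) ^+ 2 + 4%:R * (b * c).
  by rewrite -yE /t; congr (_ ^+ 2); field; rewrite b0 F2.
have : 4%:R * b * (c + d * t - t * (a + b * t)) = 0.
  rewrite (_ : 4%:R * b * _ = (a - d) ^+ 2 + 4%:R * (b * c) - (2%:R * b * t + (a - d)) ^+ 2).
    by rewrite yE subrr.
  by ring.
move/eqP; rewrite !mulf_eq0 (negPf b0) orbF (_ : 4%:R = 2%:R * 2%:R); last by ring.
by rewrite mulf_eq0 (negPf F2).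
Qed.

End MobiusSign.

(** * Hurwitz integers *)

Section QuaternionNorm.
Variable K : comNzRingType.
Implicit Types x y : quat K.

Lemma qnormM x y : qnorm (x * y) = qnorm x * qnorm y.
Proof. by rewrite /qnorm /=; ring. Qed.

Lemma qnorm1 : qnorm (1 : quat K) = 1.
Proof. by rewrite /qnorm /=; ring. Qed.

Lemma qnorm_conj x : qnorm (qconj x) = qnorm x.
Proof. by rewrite /qnorm /=; ring. Qed.

Lemma conjq_mul x : qconj x * x = Quat (qnorm x) 0 0 0.
Proof. by apply: quat_eq; rewrite /= /qnorm; ring. Qed.

Lemma quat_nat n : n%:R = Quat n%:R 0 0 0 :> quat K.
Proof.
elim: n => [|n IH] //; rewrite -[in LHS]addn1 natrD IH.
by apply: quat_eq => /=; rewrite ?addr0// -addn1 natrD.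
Qed.

Lemma quat_int n : n%:~R = Quat n%:~R 0 0 0 :> quat K.
Proof.
case: n => n; first by rewrite -!pmulrn quat_nat.
by rewrite NegzE !mulrNz -!pmulrn quat_nat; apply: quat_eq => /=; rewrite ?oppr0.
Qed.

End QuaternionNorm.

Section HurwitzArithmetic.
Variable R : realType.
Implicit Types x y z : hurwitz R.

Lemma hvalM x y : hval (x * y) = hval x * hval y. Proof. by []. Qed.
Lemma hvalB x y : hval (x - y) = hval x - hval y. Proof. by []. Qed.
Lemma hval1 : hval (1 : hurwitz R) = 1. Proof. by []. Qed.
Lemma hval_int n : hval (n%:~R : hurwitz R) = Quat n%:~R 0 0 0.
Proof. by rewrite -[hval _]/(val _) rmorph_int quat_int. Qed.

Lemma hval_nat n : hval (n%:R : hurwitz R) = Quat n%:R 0 0 0.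
Proof. by rewrite -[hval _]/(val _) rmorph_nat quat_nat. Qed.

(** The norm of a Hurwitz integer is a natural number, so neither the floor nor the absolute value
    loses anything; see [hnormE]. *)
Definition hnorm x : nat := absz (Num.floor (qnorm (hval x))).

Lemma hnormE x : (hnorm x)%:R = qnorm (hval x).
Proof.
have /floorK nE : qnorm (hval x) \is a Num.int.
  case: x => _ /= /is_hurwitzP[m [a [b [c ->]]]]; apply/intrP.
  exists (m ^+ 2 + m * (a + b + c) + a ^+ 2 + b ^+ 2 + c ^+ 2).
  by rewrite /qnorm /= !(intrD, intrM, rmorphXn) /=; field.
rewrite /hnorm natr_absz ger0_norm ?nE//.
by rewrite -(ler_int R) nE /qnorm !addr_ge0 ?sqr_ge0.
Qed.

Lemma hnormP x n : (qnorm (hval x) = n%:R) <-> hnorm x = n.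
Proof.
rewrite -hnormE; split=> [/eqP|->//]; first by rewrite eqr_nat => /eqP.
Qed.

Lemma hnormM x y : hnorm (x * y) = (hnorm x * hnorm y)%N.
Proof.
by apply/hnormP; rewrite hvalM qnormM -!hnormE natrM.
Qed.

Lemma hnorm1 : hnorm 1 = 1%N.
Proof. by apply/hnormP; rewrite hval1 qnorm1. Qed.

Lemma hnorm_nat n : hnorm n%:R = (n ^ 2)%N.
Proof.
by apply/hnormP; rewrite hval_nat /qnorm /= natrX expr0n /=; ring.
Qed.

Lemma qnorm_eq0 (z : quat R) : (qnorm z == 0) = (z == 0).
Proof.
apply/eqP/eqP => [|->]; last by rewrite /qnorm /= expr0n !addr0.
rewrite /qnorm => z0.
have := (sqr_ge0 (qre z), sqr_ge0 (qi z), sqr_ge0 (qj z), sqr_ge0 (qk z)).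
move=> -[[[a0 b0] c0] d0].
by apply: quat_eq => /=; apply/eqP; rewrite -sqrf_eq0; apply/eqP; lra.
Qed.

Lemma hnorm_eq0 x : (hnorm x == 0%N) = (x == 0).
Proof. by rewrite -(eqr_nat R) hnormE qnorm_eq0. Qed.

Lemma is_hurwitz_conj x : is_hurwitz (qconj (hval x)).
Proof.
case: x => _ /= /is_hurwitzP[m [a [b [c ->]]]]; apply/is_hurwitzP.
exists m, (- a - m), (- b - m), (- c - m).
by apply: quat_eq; rewrite /= ?intrB ?intrN; field.
Qed.

Definition hconj x := Hurwitz (is_hurwitz_conj x).

Lemma hnorm_conj x : hnorm (hconj x) = hnorm x.
Proof. by rewrite /hnorm qnorm_conj. Qed.

Lemma hmul_conj x : x * hconj x = (hnorm x)%:R.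
Proof. by apply/val_inj; rewrite /= hval_nat hnormE mulq_conj. Qed.

Lemma hconj_mul x : hconj x * x = (hnorm x)%:R.
Proof. by apply/val_inj; rewrite /= hval_nat hnormE conjq_mul. Qed.

Lemma hunitP x : hunit x <-> hnorm x = 1%N.
Proof.
split=> [[y [xy _]]|x1]; last by exists (hconj x); rewrite hmul_conj hconj_mul x1.
by apply/eqP; have /eqP := congr1 hnorm xy; rewrite hnormM hnorm1 muln_eq1 => /andP[].
Qed.

(** In a factorization of an element of prime norm one factor has norm 1, hence is a unit.
    Irreducibility therefore reduces to a condition on the norm. *)
Lemma primes_of_normP p x : prime p -> primes_of_norm p x <-> hnorm x = p.
Proof.
move=> pp; split=> [[_ /hnormP]//|xp].
split; last exact/hnormP.
split=> [/hunitP x1|y z xyz]; first by rewrite -xp x1 in pp.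
have [/eqP y1|y1] := boolP (hnorm y == 1%N); first by left; apply/hunitP.
right; apply/hunitP; move: xp; rewrite xyz hnormM => yzp.
have : (hnorm y %| p)%N by rewrite -yzp dvdn_mulr.
move=> /(prime_nt_dvdP pp y1) yp; move: yzp; rewrite yp => /eqP.
by rewrite -[eqbRHS]muln1 eqn_pmul2l ?prime_gt0// => /eqP.
Qed.

(* Rounding the coordinates of z to integers leaves an error of norm 1 only
   when every coordinate of z is a half integer, that is, z is itself Hurwitz. *)
Lemma exists_close_hurwitz (z : quat R) :
  exists q : hurwitz R, qnorm (z - hval q) < 1.
Proof.
pose n (r : R) := Num.floor (r + 2^-1).
have nP r : - 2^-1 <= r - (n r)%:~R < 2^-1.
  have := floor_le_tmp (r + 2^-1); have := floorD1_gt (r + 2^-1).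
  rewrite intrD -/(n r); lra.
have [|] := boolP ([&& qre z - (n (qre z))%:~R == - 2^-1,
  qi z - (n (qi z))%:~R == - 2^-1, qj z - (n (qj z))%:~R == - 2^-1 &
  qk z - (n (qk z))%:~R == - 2^-1]).
  move=> /and4P[/eqP a /eqP b /eqP c /eqP d].
  have zH : is_hurwitz z.
    apply/orP; right.
    have shift r : r - (n r)%:~R = - 2^-1 -> r - 2^-1 \is a Num.int.
      by move=> rE; apply/intrP; exists (n r - 1); rewrite intrB; lra.
    by rewrite !shift.
  by exists (Hurwitz zH); rewrite /= subrr /qnorm /= expr0n !addr0 ltr01.
move=> notall.
have qH : is_hurwitz (Quat (n (qre z))%:~R (n (qi z))%:~R (n (qj z))%:~R
    (n (qk z))%:~R : quat R).
  by apply/orP; left; rewrite /= !intr_int.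
exists (Hurwitz qH); rewrite /qnorm /=.
move: (nP (qre z)) (nP (qi z)) (nP (qj z)) (nP (qk z)) notall.
move: (_ - _) (_ - _) (_ - _) (_ - _) => a b c d a2 b2 c2 d2.
have le4 (r : R) : - 2^-1 <= r < 2^-1 -> r ^+ 2 <= 4^-1 ?= iff (r == - 2^-1).
  move=> /andP[r1 r2]; split; first by nra.
  apply/eqP/eqP => [|->]; last by field.
  move=> r4; have : (r - 2^-1) * (r + 2^-1) = 0 by rewrite -[RHS](subrr (r ^+ 2)) {2}r4; field.
  by move=> /eqP; rewrite mulf_eq0 => /orP[] /eqP; lra.
have := leifD (leifD (leifD (le4 _ a2) (le4 _ b2)) (le4 _ c2)) (le4 _ d2).
rewrite !andbA => L notall.
have -> : 1 = 4^-1 + 4^-1 + 4^-1 + 4^-1 :> R by field.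
by rewrite (lt_leif L).
Qed.

Lemma hurwitz_division x y : y != 0 ->
  exists q : hurwitz R, (hnorm (x - q * y)%R < hnorm y)%N.
Proof.
move=> y0; have Ny0 : qnorm (hval y) != 0 by rewrite qnorm_eq0.
(* This is x y^-1, with the inverse written as the conjugate over the norm. *)
pose z := hval x * (Quat (qnorm (hval y))^-1 0 0 0 * qconj (hval y)).
have zy : z * hval y = hval x.
  rewrite /z -!mulrA conjq_mul -[RHS]mulr1; congr (_ * _).
  by apply: quat_eq; rewrite /= ?mulVf//; ring.
have [q q1] := exists_close_hurwitz z; exists q.
rewrite -(ltr_nat R) !hnormE hvalB hvalM -zy -mulrBl qnormM.
by rewrite gtr_pMl// lt_def Ny0 /qnorm !addr_ge0 ?sqr_ge0.
Qed.

(** A nonzero element of least norm generates: the remainder of a division by it lies in [I] and has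
    smaller norm. *)
Lemma hurwitz_left_principal (I : hurwitz R -> Prop) :
  (forall x y, I x -> I y -> I (x - y)) -> (forall a x, I x -> I (a * x)) ->
  (exists2 x, I x & x != 0) ->
  exists P, [/\ P != 0, I P & forall x, I x -> exists y, x = y * P].
Proof.
move=> IB IM [x0 Ix0 x0n0].
pose S n := `[< exists x, [/\ I x, x != 0 & hnorm x = n] >].
have exS : exists n, S n by exists (hnorm x0); apply/asboolP; exists x0.
case: (ex_minnP exS) => m /asboolP[P [IP P0 <-]] min.
exists P; split=> // x Ix; have [q qP] := hurwitz_division x P0.
exists q; apply/eqP; rewrite -subr_eq0; apply: contraTT qP => r0; rewrite -leqNgt.
by apply: min; apply/asboolP; exists (x - q * P); split=> //; apply/IB/IM.
Qed.

End HurwitzArithmetic.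

(** * Reduction modulo an odd prime *)

Section Reduction.
Variables (R : realType) (K : fieldType).
Hypothesis K2 : 2%:R != 0 :> K.
Implicit Types x y : hurwitz R.

(** Doubling clears the denominators 2, so that the coordinates can be mapped to any ring; the
    floors are exact by [dblE]. *)
Definition dbl x : quat int :=
  Quat (Num.floor (2 * qre (hval x))) (Num.floor (2 * qi (hval x)))
       (Num.floor (2 * qj (hval x))) (Num.floor (2 * qk (hval x))).

Lemma dblP x m a b c :
  hval x = Quat (m%:~R / 2) (a%:~R + m%:~R / 2)
             (b%:~R + m%:~R / 2) (c%:~R + m%:~R / 2) ->
  dbl x = Quat m (2 * a + m) (2 * b + m) (2 * c + m).
Proof.
have fl (n : int) r : r = n%:~R -> Num.floor (r : R) = n by move=> ->; exact: intrKfloor.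
move=> E; rewrite /dbl E /=; congr Quat; apply: fl; rewrite ?intrD ?intrM; by field.
Qed.

Lemma dblE x : hval x = Quat ((qre (dbl x))%:~R / 2) ((qi (dbl x))%:~R / 2)
                          ((qj (dbl x))%:~R / 2) ((qk (dbl x))%:~R / 2).
Proof.
have [m [a [b [c E]]]] := is_hurwitzP _ (hvalP x).
by rewrite (dblP E) E /=; apply: quat_eq; rewrite /= ?intrD ?intrM; field.
Qed.

Lemma dbl_parity x : exists m a b c : int,
  dbl x = Quat m (2 * a + m) (2 * b + m) (2 * c + m).
Proof.
have [m [a [b [c E]]]] := is_hurwitzP _ (hvalP x).
by exists m, a, b, c; exact: dblP.
Qed.

Lemma dbl_surj m a b c : exists x,
  dbl x = Quat m (2 * a + m) (2 * b + m) (2 * c + m).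
Proof.
have H : is_hurwitz (Quat (m%:~R / 2) (a%:~R + m%:~R / 2)
             (b%:~R + m%:~R / 2) (c%:~R + m%:~R / 2) : quat R).
  by apply/is_hurwitzP; exists m, a, b, c.
by exists (Hurwitz H); apply: dblP.
Qed.

Lemma quat_intr_inj (X Y : quat int) :
  (qre X)%:~R = (qre Y)%:~R :> R -> (qi X)%:~R = (qi Y)%:~R :> R ->
  (qj X)%:~R = (qj Y)%:~R :> R -> (qk X)%:~R = (qk Y)%:~R :> R -> X = Y.
Proof. by move=> a b c d; apply: quat_eq; apply: (@intr_inj R). Qed.

Lemma dblB x y : dbl (x - y) = dbl x - dbl y.
Proof.
have /(congr1 (fun z => z + z)) := hvalB x y; rewrite !dblE => -[] a b c d.
by apply: quat_intr_inj; rewrite /= intrD intrN; lra.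
Qed.

Lemma dblM x y : dbl (x * y) + dbl (x * y) = dbl x * dbl y.
Proof.
have := hvalM x y; rewrite (dblE (x * y)) (dblE x) (dblE y) => -[] a b c d.
apply: quat_intr_inj; rewrite /= !(intrD, intrN, intrM).
- move: a => /(canRL (mulfVK _))-> ; rewrite ?pnatr_eq0//; by field.
- move: b => /(canRL (mulfVK _))-> ; rewrite ?pnatr_eq0//; by field.
- move: c => /(canRL (mulfVK _))-> ; rewrite ?pnatr_eq0//; by field.
- move: d => /(canRL (mulfVK _))-> ; rewrite ?pnatr_eq0//; by field.
Qed.

Lemma dbl_qnorm x : qnorm (dbl x) = (4 * hnorm x)%:Z.
Proof.
apply: (@intr_inj R); rewrite PoszM intrM [(hnorm x)%:~R]hnormE (dblE x).
rewrite /qnorm /= !(intrD, rmorphXn) /=; by field.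
Qed.

(** Halving in [K] undoes the doubling and makes the reduction multiplicative when 2 is
    invertible. *)
Definition hreduce x : quat K :=
  Quat ((qre (dbl x))%:~R / 2%:R) ((qi (dbl x))%:~R / 2%:R)
       ((qj (dbl x))%:~R / 2%:R) ((qk (dbl x))%:~R / 2%:R).

Lemma hreduceB x y : hreduce (x - y) = hreduce x - hreduce y.
Proof. by rewrite /hreduce dblB; apply: quat_eq; rewrite /= intrB mulrBl. Qed.

Lemma hreduceM x y : hreduce (x * y) = hreduce x * hreduce y.
Proof.
have E (n m : int) : n + n = m -> n%:~R / 2%:R = m%:~R / 2%:R / 2%:R :> K.
  by move=> <-; rewrite intrD; field.
have [a b c d] := dblM x y.
by apply: quat_eq => /=; [rewrite (E _ _ a)|rewrite (E _ _ b)|rewrite (E _ _ c)|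
  rewrite (E _ _ d)]; rewrite !(intrD, intrN, intrM); field.
Qed.

Lemma hreduce_int n : hreduce n%:~R = Quat n%:~R 0 0 0.
Proof.
have dE : dbl n%:~R = Quat (2 * n) (2 * (- n) + 2 * n) (2 * (- n) + 2 * n)
    (2 * (- n) + 2 * n).
  by apply: dblP; rewrite hval_int; apply: quat_eq => /=;
    rewrite ?intrM ?intrN; field.
by rewrite /hreduce dE mulrN addNr mul0r intrM; apply: quat_eq => //=; field.
Qed.

Lemma qnorm_hreduce x : qnorm (hreduce x) = (hnorm x)%:R.
Proof.
have K4 : 4%:R != 0 :> K by rewrite (natrM _ 2 2) mulf_neq0.
apply: (mulfI K4); rewrite -natrM [RHS]pmulrn -dbl_qnorm.
by rewrite /qnorm /= !(intrD, rmorphXn) /=; field.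
Qed.

Lemma qtrace_hreduce x : qtrace (hreduce x) = (htrace x)%:~R.
Proof.
(* Both sides are the floor of twice the real part, hence convertible. *)
rewrite /qtrace /= (_ : htrace x = qre (dbl x)); first by field.
by [].
Qed.

Lemma hreduce_surj_int (a b c d : int) :
  exists x, hreduce x = Quat a%:~R b%:~R c%:~R d%:~R.
Proof.
(* With these arguments the doubled coordinates are 2a, 2b, 2c, 2d. *)
have [x xE] := dbl_surj (2 * a) (b - a) (c - a) (d - a); exists x.
by rewrite /hreduce xE; apply: quat_eq; rewrite /= ?intrD ?intrM ?intrB; field.
Qed.

End Reduction.

(** * Isomorphism of the quaternions over a finite field with 2 by 2 matrices *)

Section SplitQuaternions.
Variable F : finFieldType.
Hypothesis F2 : 2%:R != 0 :> F.
Variables u v : F.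
Hypothesis uv : u ^+ 2 + v ^+ 2 = -1.
Implicit Types x y : quat F.

(* i and j are sent to [[0, -1], [1, 0]] and [[u, v], [v, -u]]. *)
Definition quat_mx x : 'M[F]_2 :=
  mx2 (qre x + qj x * u - qk x * v) (- qi x + qj x * v + qk x * u)
      (qi x + qj x * v + qk x * u) (qre x - qj x * u + qk x * v).

Lemma mx2_eq (a b c d a' b' c' d' : F) :
  a = a' -> b = b' -> c = c' -> d = d' -> mx2 a b c d = mx2 a' b' c' d'.
Proof. by move=> -> -> -> ->. Qed.

(** The relation [uv] says that the image of j squares to -1. *)
Lemma quat_mxM x y : quat_mx (x * y) = quat_mx x *m quat_mx y.
Proof.
have u2 : u ^+ 2 = -1 - v ^+ 2 by rewrite -uv addrK.
by rewrite /quat_mx mx2M; apply: mx2_eq => /=; ring: u2.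
Qed.

Lemma quat_mxB x y : quat_mx (x - y) = quat_mx x - quat_mx y.
Proof.
apply/matrixP => i j; rewrite !mxE /=.
by have [->|->] := ord2P i; have [->|->] := ord2P j => /=; ring.
Qed.

Lemma quat_mx_scalar a : quat_mx (Quat a 0 0 0) = a%:M.
Proof.
apply/matrixP => i j; rewrite !mxE /=.
by have [->|->] := ord2P i; have [->|->] := ord2P j => /=; ring.
Qed.

Lemma det_quat_mx x : \det (quat_mx x) = qnorm x.
Proof.
have u2 : u ^+ 2 = -1 - v ^+ 2 by rewrite -uv addrK.
by rewrite det_mx2E /qnorm; ring: u2.
Qed.

Lemma tr_quat_mx x : \tr (quat_mx x) = qtrace x.
Proof. by rewrite /mxtrace !big_ord_recl big_ord0 !mxE /= /qtrace; ring. Qed.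

(** The trace-free symmetric part [[s, t], [t, -s]] comes from the coordinates of j and k through a
    linear map of determinant u^2 + v^2 = -1, inverted here. *)
Definition mx_quat (A : 'M[F]_2) : quat F :=
  let s := (A 0 0 - A 1 1) / 2%:R in let t := (A 0 1 + A 1 0) / 2%:R in
  Quat ((A 0 0 + A 1 1) / 2%:R) ((A 1 0 - A 0 1) / 2%:R)
       (- (s * u + t * v)) (s * v - t * u).

Lemma quat_mxK : cancel quat_mx mx_quat.
Proof.
have u2 : u ^+ 2 = -1 - v ^+ 2 by rewrite -uv addrK.
move=> x; rewrite /mx_quat /quat_mx !mxE /=.
apply: quat_eq => /=; apply: (mulfI F2); field: u2 => //.
Qed.

Lemma mx_quatK : cancel mx_quat quat_mx.
Proof.
have u2 : u ^+ 2 = -1 - v ^+ 2 by rewrite -uv addrK.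
move=> A; rewrite [RHS]mx2P /quat_mx /mx_quat.
apply: mx2_eq => /=; apply: (mulfI F2); field: u2 => //.
Qed.

End SplitQuaternions.

Lemma prime_class_eq (R : realType) p (P P' : hurwitz R) (Pp : primes_of_norm p P)
    (Pp' : primes_of_norm p P') :
  prime_class Pp = prime_class Pp' <-> left_assoc P P'.
Proof.
rewrite -left_class_eqP; split=> [/(congr1 val)//|PP'].
by apply/val_inj.
Qed.

(** * Metacommutation as a projective transformation over [F_p], for odd p *)

Section OddPrime.
Variables (R : realType) (p : nat).
Hypotheses (pp : prime p) (p2 : p != 2%N).
Local Notation F := 'F_p.
Implicit Types (x y z P Q : hurwitz R) (t : option F).

Lemma Fp_int_eq0 (n : int) : (n%:~R == 0 :> F) = (p %| n)%Z.
Proof.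
have natE (m : nat) : (m%:R == 0 :> F) = (p %| m)%N.
  by rewrite -(dvdn_pcharf (pchar_Fp pp)).
by case: n => n; rewrite ?NegzE ?mulrNz ?oppr_eq0 dvdzE -pmulrn natE.
Qed.

Lemma Fp_char_neq2 : 2%:R != 0 :> F.
Proof.
by rewrite (Fp_int_eq0 2) dvdzE dvdn_prime2.
Qed.

Let F2 := Fp_char_neq2.

Lemma Fp_intP (a : F) : exists n : int, a = n%:~R.
Proof. by exists (a : nat)%:Z; rewrite -pmulrn natr_Zp. Qed.

Lemma legendreE (a : int) : legendre a p = quadratic_char (a%:~R : F).
Proof.
rewrite /legendre /quadratic_char Fp_int_eq0; case: ifP => // _.
congr (if _ then _ else _); apply/asboolP/is_squareP => -[x].
  move=> /eqP; rewrite eqz_mod_dvd -Fp_int_eq0 intrB subr_eq0 => /eqP <-.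
  by exists x%:~R; rewrite rmorphXn.
have [n ->] := Fp_intP x => nE; exists n; apply/eqP.
by rewrite eqz_mod_dvd -Fp_int_eq0 intrB subr_eq0 -nE rmorphXn.
Qed.

Variables u v : F.
Hypothesis uv : u ^+ 2 + v ^+ 2 = -1.

(** Reduction modulo p followed by the splitting: a ring map to M_2(F_p) taking norm to determinant
    and reduced trace to trace. *)
Definition Phi x : 'M[F]_2 := quat_mx u v (hreduce F x).

Lemma PhiM x y : Phi (x * y) = Phi x *m Phi y.
Proof. by rewrite /Phi hreduceM ?quat_mxM. Qed.

Lemma PhiB x y : Phi (x - y) = Phi x - Phi y.
Proof. by rewrite /Phi hreduceB ?quat_mxB. Qed.

Lemma Phi_int n : Phi n%:~R = (n%:~R)%:M.
Proof. by rewrite /Phi hreduce_int ?quat_mx_scalar. Qed.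

Lemma Phi_nat n : Phi n%:R = (n%:R)%:M.
Proof. by rewrite [n%:R in LHS]pmulrn Phi_int -pmulrn. Qed.

Lemma det_Phi x : \det (Phi x) = (hnorm x)%:R.
Proof. by rewrite /Phi det_quat_mx ?qnorm_hreduce. Qed.

Lemma tr_Phi x : \tr (Phi x) = (htrace x)%:~R.
Proof. by rewrite /Phi tr_quat_mx ?qtrace_hreduce. Qed.

Lemma Phi_surj (A : 'M[F]_2) : exists x, Phi x = A.
Proof.
case E : (mx_quat u v A) => [a b c d].
have [[a' aE] [b' bE]] := (Fp_intP a, Fp_intP b).
have [[c' cE] [d' dE]] := (Fp_intP c, Fp_intP d).
have [x xE] := hreduce_surj_int R F2 a' b' c' d'; exists x.
by rewrite /Phi xE -aE -bE -cE -dE -E mx_quatK.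
Qed.

Lemma Phi_eq0P x : Phi x = 0 <-> exists y, x = p%:R * y.
Proof.
have Fp0 : p%:R = 0 :> F by apply/eqP; rewrite (Fp_int_eq0 p) dvdzz.
split=> [x0|[y ->]]; last by rewrite PhiM Phi_nat Fp0 mul_scalar_mx scale0r.
have [m [a [b [c dx]]]] := dbl_parity x.
have h0 : hreduce F x = 0.
  apply: (can_inj (quat_mxK F2 uv)); rewrite -[LHS]/(Phi x) x0.
  by rewrite -[0 in RHS]/(Quat 0 0 0 0) quat_mx_scalar -scalemx1 scale0r.
have half n : n%:~R / 2%:R = 0 :> F -> (p %| n)%Z.
  by move/eqP; rewrite mulf_eq0 invr_eq0 (negPf F2) orbF Fp_int_eq0.
rewrite /hreduce dx /= in h0.
have [pm pa] := (half _ (congr1 (@qre _) h0), half _ (congr1 (@qi _) h0)).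
have [pb pc] := (half _ (congr1 (@qj _) h0), half _ (congr1 (@qk _) h0)).
(* As p is odd, it divides [a], [b], [c] as well as [m], so the quotient by p has again the parity
   pattern of a Hurwitz integer. *)
have dvdp n : (p %| (2 * n + m)%R)%Z -> (p %| n)%Z.
  by rewrite rpredDr// Gauss_dvdzr// coprimezE prime_coprime// dvdn_prime2.
have /dvdzP[m' mE] := pm; have /dvdzP[a' aE] := dvdp _ pa.
have /dvdzP[b' bE] := dvdp _ pb; have /dvdzP[c' cE] := dvdp _ pc.
have [y yE] := dbl_surj R m' a' b' c'; exists y; apply/val_inj.
rewrite [RHS]hvalM hval_nat [LHS](dblE x) (dblE y) dx yE mE aE bE cE.
by apply: quat_eq; rewrite /= !(intrD, intrM); field.
Qed.

Lemma Phi_neq0 P : hnorm P = p -> Phi P != 0.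
Proof.
move=> Pp; apply/eqP => /Phi_eq0P[y Py]; move: Pp; rewrite Py hnormM hnorm_nat.
move=> /eqP; rewrite -[eqbRHS]muln1 -mulnn -mulnA eqn_pmul2l ?prime_gt0//.
by rewrite muln_eq1 => /andP[/eqP p1]; move: pp; rewrite p1.
Qed.

Definition kills P t := Phi P *m pvec t = 0.

Lemma kills_exists P : hnorm P = p -> exists t, kills P t.
Proof.
(* The transpose appears because [det0P] provides a row vector. *)
move=> Pp; have : \det (Phi P)^T == 0.
  by rewrite det_tr det_Phi Pp (Fp_int_eq0 p) dvdzz.
move=> /det0P[w w0 wP]; have wT0 : w^T != 0 by rewrite trmx_eq0.
have [c c0 wE] := pvec_ppoint wT0; exists (ppoint w^T).
have Pw : Phi P *m w^T = 0 by apply: trmx_inj; rewrite trmx_mul trmxK wP trmx0.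
have wc : pvec (ppoint w^T) = c^-1 *: w^T by rewrite {2}wE scalerA mulVf// scale1r.
by rewrite /kills wc -scalemxAr Pw scaler0.
Qed.

Lemma kills_unique P t t' : hnorm P = p -> kills P t -> kills P t' -> t = t'.
Proof. by move=> /Phi_neq0 P0 Pt Pt'; exact: pvec_kernel_unique P0 Pt Pt'. Qed.

Lemma kills_mul z P t : kills P t -> kills (z * P) t.
Proof. by rewrite /kills PhiM -mulmxA => ->; rewrite mulmx0. Qed.

Lemma left_assoc_kills P P' t : left_assoc P P' -> kills P t -> kills P' t.
Proof. by move=> [z _ ->]; exact: kills_mul. Qed.

(* The left ideal of the elements killing t contains p but not 1, so the norm
   of a generator is p or p^2; in the latter case the ideal would be generated
   by p, whereas Phi is onto. *)
Lemma kills_generator t :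
  exists P, [/\ hnorm P = p, kills P t & forall x, kills x t -> exists y, x = y * P].
Proof.
have Phip : Phi p%:R = 0 by apply/Phi_eq0P; exists 1; rewrite mulr1.
have pt : kills p%:R t by rewrite /kills Phip mul0mx.
have [x y xt yt|a x xt||P [P0 Pt gen]] := @hurwitz_left_principal R (kills ^~ t).
- by rewrite /kills PhiB mulmxBl xt yt subrr.
- exact: kills_mul.
- exists p%:R => //; by rewrite -hnorm_eq0 hnorm_nat expn_eq0 -leqn0 leqNgt prime_gt0.
exists P; split=> //.
have [y pE] := gen _ pt.
have := congr1 (@hnorm R) pE; rewrite hnorm_nat hnormM => NE.
have /(dvdn_pfactor _ _ pp)[k k2 Pk] : (hnorm P %| p ^ 2)%N.
  by rewrite NE dvdn_mull.
case: k k2 Pk => [|[|[|//]]] _; last 2 first.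
- by rewrite expn1.
- move=> Pk; have y1 : hnorm y = 1%N.
    have p20 : (0 < p ^ 2)%N by rewrite expn_gt0 prime_gt0.
    by apply/eqP; rewrite -(eqn_pmul2r p20) mul1n -[in eqbLHS]Pk -NE.
  have PhiP : Phi P = 0.
    have -> : P = hconj y * p%:R by rewrite pE mulrA hconj_mul y1 mul1r.
    by rewrite PhiM Phip mulmx0.
  (* A nonzero matrix killing t. A lift of it would be a multiple of [P], whose image is 0. *)
  pose M : 'M[F]_2 := if t is Some a then mx2 (- a) 1 0 0 else mx2 1 0 0 0.
  have [x xM] := Phi_surj M.
  have [z xz] : exists z, x = z * P.
    apply: gen; rewrite /kills xM /M; apply/colP => i; case: (t) => [a|];
      rewrite !mxE !big_ord_recl big_ord0 !mxE /=;
      by have [->|->] := ord2P i => /=; ring.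
  have : M = 0 by rewrite -xM xz PhiM PhiP mulmx0.
  case: (t) @M {xM} => [a|] /= /matrixP => [/(_ 0 1)|/(_ 0 0)];
    by rewrite !mxE /= => /eqP; rewrite oner_eq0.
rewrite expn0 => P1; have [] := negP (pvec_neq0 t).
have : kills 1 t.
  by rewrite (_ : 1 = hconj P * P); [exact: kills_mul|rewrite hconj_mul P1].
by rewrite /kills (Phi_nat 1) mul1mx => ->.
Qed.

(** Both elements are left multiples of one generator of norm p, so the cofactors have norm 1. *)
Lemma kills_left_assoc P P' t :
  hnorm P = p -> hnorm P' = p -> kills P t -> kills P' t -> left_assoc P P'.
Proof.
move=> Pp Pp' Pt Pt'; have [G [Gp Gt gen]] := kills_generator t.
have unit1 y : hnorm (y * G) = p -> hnorm y = 1%N.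
  move=> /eqP; rewrite hnormM Gp -[eqbRHS]mul1n eqn_pmul2r ?prime_gt0//.
  by move=> /eqP.
have [[y PE] [y' PE']] := (gen P Pt, gen P' Pt').
rewrite PE in Pp; rewrite PE' in Pp'.
have [y1 y1'] := (unit1 _ Pp, unit1 _ Pp').
exists (y' * hconj y); last by rewrite PE PE' -!mulrA (mulrA (hconj y)) hconj_mul y1 mul1r.
by apply/hunitP; rewrite hnormM y1' mul1n hnorm_conj.
Qed.

Lemma Phi_unitmx Q q : prime q -> p <> q -> hnorm Q = q -> Phi Q \in unitmx.
Proof.
move=> qp pq Qq; rewrite unitmxE det_Phi unitfE Qq (Fp_int_eq0 q) dvdzE.
by rewrite dvdn_prime2//; apply/eqP.
Qed.

(** Applying PQ = Q'P' to t' gives 0, so [P] kills the image of t' under [Q], and [P] kills only one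
    point. *)
Lemma metacommutation_kills P Q Q' P' t t' : hnorm P = p -> Phi Q \in unitmx ->
  P * Q = Q' * P' -> kills P t -> kills P' t' -> mobius (Phi Q) t' = t.
Proof.
move=> Pp uQ PQ Pt P't'; apply: (kills_unique Pp) => //.
apply: mobius_kernel => //.
by rewrite -PhiM PQ PhiM -mulmxA P't' mulmx0.
Qed.

(** PQ kills the preimage t' of t under [Q], hence is a left multiple of the generator [P'] attached
    to t'; comparing norms gives that of the cofactor. *)
Lemma metacommutation_exists P Q : hnorm P = p -> Phi Q \in unitmx ->
  exists Q' P', [/\ hnorm Q' = hnorm Q, hnorm P' = p & P * Q = Q' * P'].
Proof.
move=> Pp uQ; have [t Pt] := kills_exists Pp.
pose t' := mobius (invmx (Phi Q)) t.
have [c Qt'] : exists c, Phi Q *m pvec t' = c *: pvec t.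
  by apply/mobiusP => //; rewrite -mobiusM ?unitmx_inv// mulmxV// mobius1.
have [P' [P'p _ gen]] := kills_generator t'.
have [|Q' PQ] := gen (P * Q).
  by rewrite /kills PhiM -mulmxA Qt' -scalemxAr Pt scaler0.
exists Q', P'; split=> //; have /eqP := congr1 (@hnorm R) PQ.
by rewrite !hnormM P'p Pp mulnC eqn_pmul2r ?prime_gt0// => /eqP.
Qed.

Lemma congr_integerP Q : congr_integer p Q <-> is_scalar_mx (Phi Q).
Proof.
split=> [[n [x Qn]]|/is_scalar_mxP[a Qa]].
  apply/is_scalar_mxP; exists n%:~R; apply/eqP.
  rewrite -subr_eq0 -Phi_int -PhiB; apply/eqP/Phi_eq0P; by exists x.
have [n an] := Fp_intP a; exists n.
by apply/Phi_eq0P; rewrite PhiB Phi_int Qa an subrr.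
Qed.

(** Classes correspond to killed points: associates kill the same point, [kills_left_assoc] gives
    injectivity and [kills_generator] surjectivity. *)
Lemma prime_classes_mobius : exists (e : prime_classes R p -> option F),
  bijective e /\ forall P (Pp : primes_of_norm p P), kills P (e (prime_class Pp)).
Proof.
have [e eP] : exists e : prime_classes R p -> option F,
    forall C P (Pp : primes_of_norm p P), C = prime_class Pp -> kills P (e C).
  suff /boolp.choice[e eP] : forall C : prime_classes R p, exists t,
      forall P (Pp : primes_of_norm p P), C = prime_class Pp -> kills P t.
    by exists e.
  move=> C.
  have [P [Pp ->]] := prime_classP C.
  have [t Pt] := kills_exists ((primes_of_normP _ pp).1 Pp).
  exists t => P' Pp' /prime_class_eq PP'; exact: left_assoc_kills PP' Pt.
exists e; split=> [|P Pp]; last exact: eP.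
have e_inj : injective e.
  move=> C C'; have [[P [Pp CE]] [P' [Pp' CE']]] := (prime_classP C, prime_classP C').
  move=> ee; rewrite CE CE'; apply/prime_class_eq.
  have [P1 P1'] := ((primes_of_normP _ pp).1 Pp, (primes_of_normP _ pp).1 Pp').
  apply: (kills_left_assoc P1 P1' (t := e C)); first exact: eP.
  by rewrite ee; exact: eP CE'.
have e_surj t : exists C, e C = t.
  have [P [P1 Pt _]] := kills_generator t.
  have Pp := (primes_of_normP P pp).2 P1.
  by exists (prime_class Pp); apply: kills_unique P1 _ Pt; exact: eP.
have [g gK] := @boolp.choice _ _ _ e_surj.
by exists g => // C; apply: e_inj; rewrite gK.
Qed.

Lemma metacommutation_perm (q : nat) Q :
  prime q -> p <> q -> hnorm Q = q ->
  exists tau : {perm prime_classes R p},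
      [/\ forall (P Q' P' : hurwitz R)
                 (Pp : primes_of_norm p P) (Pp' : primes_of_norm p P'),
            P * Q = Q' * P' -> tau (prime_class Pp) = prime_class Pp',
          (-1) ^+ tau = legendre q p,
          congr_integer p Q -> tau = 1%g
        & ~ congr_integer p Q ->
          #|[set C | tau C == C]|%:Z
            = 1 + legendre (htrace Q ^+ 2 - 4 * q%:Z) p].
Proof.
move=> qp pq Qq; have uQ := Phi_unitmx qp pq Qq.
have [e [[g eK gK] ekills]] := prime_classes_mobius.
pose s := mobius_perm uQ.
(* The inverse of [s] occurs because [Q] maps the point of P' back to the point of P. *)
have f_inj : injective (fun C => g ((s^-1)%g (e C))).
  by move=> C C' /(can_inj gK)/perm_inj/(can_inj eK).
pose tau := perm f_inj.
have etau C : s (e (tau C)) = e C by rewrite (permE f_inj) gK permKV.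
have tauP C C' : s (e C') = e C -> tau C = C'.
  by move=> sC; apply/(can_inj eK)/(@perm_inj _ s); rewrite etau sC.
exists tau; split.
- move=> P Q' P' Pp Pp' PQ; apply: tauP; rewrite permE.
  apply: (metacommutation_kills _ uQ PQ) => //; exact/primes_of_normP.
- have -> : odd_perm tau = odd_perm s.
    rewrite -(odd_permV s); apply/esym/(odd_perm_bij (f := e)).
      by exists g.
    by move=> C; apply: (@perm_inj _ s); rewrite permKV etau.
  rewrite odd_mobius_perm// det_Phi Qq legendreE /quadratic_char -pmulrn.
  have -> : (q%:R == 0 :> F) = false.
    by rewrite (Fp_int_eq0 q) dvdzE dvdn_prime2//; apply/eqP.
  by case: is_square.
- move=> /congr_integerP/is_scalar_mxP[a Qa]; apply/permP => C.
  rewrite perm1; apply: tauP; rewrite permE; apply/mobiusP => //.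
  by exists a; rewrite Qa mul_scalar_mx.
move=> ncongr; rewrite legendreE intrB rmorphXn /= intrM -tr_Phi.
rewrite -[q%:~R]/(q%:R) -Qq -det_Phi -mobius_fixed_points//; last first.
  by apply/negP => /congr_integerP.
rewrite -(card_imset _ (can_inj eK)); congr (Posz #|pred_of_set _|).
(* The bijection [e] matches the fixed classes of [tau] with the fixed points of [Phi Q]. *)
apply/finset.setP => t; rewrite inE; apply/imsetP/eqP => [[C]|tQ].
  by rewrite inE => /eqP tC ->; have := etau C; rewrite tC permE.
exists (g t); last by rewrite gK.
by rewrite inE; apply/eqP/tauP; rewrite permE gK.
Qed.

End OddPrime.

(** * The prime 2 *)

Section PrimeTwo.
Variable R : realType.
Implicit Types P Q : hurwitz R.

Fact is_hurwitz_1i : is_hurwitz (Quat 1 1 0 0 : quat R).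
Proof. by apply/orP; left; rewrite /= !rpred1 !rpred0. Qed.

Definition one_plus_i := Hurwitz is_hurwitz_1i.

Lemma hnorm_1i : hnorm one_plus_i = 2%N.
Proof. by apply/hnormP; rewrite /qnorm /=; ring. Qed.

Lemma even_hnorm_mul P : ~~ odd (hnorm P) -> exists y, P = y * one_plus_i.
Proof.
move=> Pev; have [m [a [b [c PE]]]] := dbl_parity P.
have NE : (hnorm P)%:Z = m ^+ 2 + m * (a + b + c) + a ^+ 2 + b ^+ 2 + c ^+ 2.
  apply: (mulfI (_ : 4%:Z != 0)) => //; rewrite -PoszM -dbl_qnorm PE /qnorm /=.
  by ring.
have half (n : int) : exists k, n = 2 * k \/ n = 2 * k + 1.
  by exists (n %/ 2)%Z; lia.
have [h hE] : exists h : nat, hnorm P = (2 * h)%N by exists (hnorm P)./2; lia.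
(* Modulo 2, squares are linear and the norm is (1 + m)(1 + a + b + c) - 1, which is even only if
   [m] and [a + b + c] both are. *)
have [[k mk] [s abc]] : (exists k, m = 2 * k) /\ exists s, a + b + c = 2 * s.
  have sqr2 (n : int) : exists j, n ^+ 2 = n + 2 * j.
    have [j [->|->]] := half n; first by exists (2 * j ^+ 2 - j); ring.
    by exists (2 * j ^+ 2 + j); ring.
  have [[k mk] [i iE]] := (half m, half (a + b + c)).
  have [[jm mE] [ja aE]] := (sqr2 m, sqr2 a).
  have [[jb bE] [jc cE]] := (sqr2 b, sqr2 c).
  have : (hnorm P)%:Z = m + m * (a + b + c) + (a + b + c) + 2 * (jm + ja + jb + jc).
    by rewrite NE mE aE bE cE; ring.
  rewrite hE PoszM; move: (jm + ja + jb + jc) => j.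
  case: mk iE => -> [] -> jE; first by split; [exists k|exists i].
  - by exfalso; have : 2 * (h%:Z - k - 2 * k * i - k - i - j) = 1; [rewrite !mulrBr jE; ring|lia].
  - by exfalso; have : 2 * (h%:Z - k - 2 * k * i - i - i - j) = 1; [rewrite !mulrBr jE; ring|lia].
  - by exfalso; have : 2 * (h%:Z - 2 * k - 2 * k * i - 2 * i - 1 - j) = 1;
      [rewrite !mulrBr jE; ring|lia].
(* These are the coordinates of P(1 - i)/2, the right quotient of P by 1 + i. *)
have [y yE] := dbl_surj R (2 * k + a) (- k) (s - a - c - k) (s - a).
exists y; apply/val_inj; rewrite [RHS]hvalM [LHS](dblE P) (dblE y) PE yE mk.
have sE : (s%:~R : R) = (a%:~R + b%:~R + c%:~R) / 2.
  by rewrite -!intrD abc intrM; field.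
by apply: quat_eq; rewrite /= !(intrD, intrM, intrN) sE; field.
Qed.

Lemma left_assoc_norm2 P Q : hnorm P = 2%N -> hnorm Q = 2%N -> left_assoc P Q.
Proof.
move=> P2 Q2; have [|y PE] := @even_hnorm_mul P; first by rewrite P2.
have [|z QE] := @even_hnorm_mul Q; first by rewrite Q2.
have unit1 w : hnorm (w * one_plus_i) = 2%N -> hnorm w = 1%N.
  by rewrite hnormM hnorm_1i; lia.
have y1 : hnorm y = 1%N by apply: unit1; rewrite -PE.
have z1 : hnorm z = 1%N by apply: unit1; rewrite -QE.
exists (z * hconj y); first by apply/hunitP; rewrite hnormM hnorm_conj y1 z1.
by rewrite PE QE -!mulrA (mulrA (hconj y)) hconj_mul y1 mul1r.
Qed.

End PrimeTwo.

Theorem theorem1p1 (R : realType) (p q : nat) (Q : hurwitz R) :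
  prime p -> prime q -> p <> q -> primes_of_norm q Q ->
  (forall P : hurwitz R, primes_of_norm p P ->
     exists Q' P' : hurwitz R,
       [/\ primes_of_norm q Q', primes_of_norm p P' & P * Q = Q' * P'])
  /\ (forall P1 Q1 P1' P2 Q2 P2' : hurwitz R,
        primes_of_norm p P1 -> primes_of_norm q Q1 -> primes_of_norm p P1' ->
        primes_of_norm p P2 -> primes_of_norm q Q2 -> primes_of_norm p P2' ->
        P1 * Q = Q1 * P1' -> P2 * Q = Q2 * P2' ->
        left_assoc P1 P2 -> left_assoc P1' P2')
  /\ exists tau : {perm prime_classes R p},
      [/\ forall (P Q' P' : hurwitz R)
                 (Pp : primes_of_norm p P) (Pp' : primes_of_norm p P'),
            primes_of_norm q Q' -> P * Q = Q' * P' ->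
            tau (prime_class Pp) = prime_class Pp',
          (-1) ^+ tau = legendre q p,
          p = 2%N \/ congr_integer p Q -> tau = 1%g
        & ~ (p = 2%N \/ congr_integer p Q) ->
          #|[set C | tau C == C]|%:Z
            = 1 + legendre (htrace Q ^+ 2 - 4 * q%:Z) p].
Proof.
move=> pp qp pq Qp; have Qq := (primes_of_normP Q qp).1 Qp.
have normP := primes_of_normP _ pp; have normQ := primes_of_normP _ qp.
have [p2|p2] := eqVneq p 2%N.
  (* For p = 2 there is a single class, so the identity is the required permutation. *)
  subst p; have assoc P P' : primes_of_norm 2 P -> primes_of_norm 2 P' ->
      left_assoc P P'.
    by move=> /normP P2 /normP P'2; exact: left_assoc_norm2.
  split=> [P /normP P2|].
    have [|Q' PQ] := @even_hnorm_mul _ (P * Q); first by rewrite hnormM P2 oddM.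
    exists Q', (one_plus_i R); split=> //; last exact/normP/hnorm_1i.
    apply/normQ/eqP; have /eqP := congr1 (@hnorm R) PQ.
    by rewrite !hnormM hnorm_1i P2 Qq mulnC eqn_pmul2r// eq_sym.
  split=> [P1 Q1 P1' P2 Q2 P2' _ _ P1p _ _ P2p _ _ _|]; first exact: assoc.
  exists 1%g; split=> // [P Q' P' Pp P'p _ _||[]]; last by left.
    by rewrite perm1; apply/prime_class_eq; exact: assoc.
  (* The identity has sign 1, and [legendre q 2] is 1 because the odd q is congruent to 1^2. *)
  have q_odd : odd q by case: (even_prime qp) => // q2; case: pq.
  rewrite odd_perm1 /legendre ifF; last by rewrite dvdzE /=; lia.
  by rewrite ifT//; apply/asboolP; exists 1; lia.
have F2 := Fp_char_neq2 pp p2.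
have [u [v uv]] := sum_two_squares F2 (-1).
have uQ := Phi_unitmx pp p2 uv qp pq Qq.
split=> [P /normP Pp|].
  have [Q' [P' [Q'q P'p PQ]]] := metacommutation_exists pp p2 uv Pp uQ.
  by exists Q', P'; split=> //; [apply/normQ; rewrite Q'q|exact/normP].
split=> [P1 Q1 P1' P2 Q2 P2' /normP P1p _ /normP P1'p /normP P2p _ /normP P2'p|].
  move=> PQ1 PQ2 P12; have [t P1t] := kills_exists pp p2 uv P1p.
  have [t1 P1't] := kills_exists pp p2 uv P1'p.
  have [t2 P2't] := kills_exists pp p2 uv P2'p.
  have P2t := left_assoc_kills pp p2 uv P12 P1t.
  (* [P1] and [P2] kill the same t, and [Q] maps both [t1] and [t2] to it. *)
  have t12 : t1 = t2.
    apply: (mobius_inj uQ).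
    rewrite (metacommutation_kills pp p2 uv P1p uQ PQ1 P1t P1't).
    by rewrite (metacommutation_kills pp p2 uv P2p uQ PQ2 P2t P2't).
  by rewrite -t12 in P2't; exact: (kills_left_assoc pp p2 uv P1'p P2'p P1't).
have [tau [tauP sign_tau tau1 fix_tau]] :=
  metacommutation_perm pp p2 uv qp pq Qq.
exists tau; split=> // [P Q' P' Pp P'p _|[/eqP|]|ncongr].
- exact: tauP.
- by rewrite (negPf p2).
- exact: tau1.
by apply: fix_tau => congr; apply: ncongr; right.
Qed.
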